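(* Let $P\bowtie G$ be a Zappa-Szép product of a semigroup $P$ and a group $G$, let $\mathcal{A}$ be a unital C*-algebra, let $X$ be a product system over $P$ with coefficient $\mathcal{A}$, let $\beta$ be a Zappa-Szép action of $G$ on $X$, and let $\mathcal{B}$ be a unital C*-algebra. There is a one-to-one correspondence $\Pi$ between the set of all (Toeplitz) representations $\Psi$ of the product system $X\bowtie G$ on $\mathcal{B}$ and the set of covariant representations $(\psi,U)$ of $(X,G,\beta)$ on $\mathcal{B}$. In fact, for a given representation $\Psi$ of $X\bowtie G$, one has $$\psi_p(x):=\Psi_{(p,e)}(x\otimes e)\quad (p\in P,\ x\in X_p),\qquad U_g:=\Psi_{(e,g)}(1_{\mathcal{A}}\otimes g)\quad (g\in G).$$ Conversely, given a covariant representation $(\psi,U)$ of $(X,G,\beta)$, one has $$\Psi_{(p,g)}(x\otimes g):=\psi_p(x)U_g\quad (p\in P,\ g\in G,\ x\in X_p).$$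
   Context: Semigroups and groups are discrete, and every semigroup has an identity, written $e$ (the identity of $G$ is also written $e$). Zappa-Szép product. One is given a left action $G\times P\to P$, $(g,p)\mapsto g\cdot p$, and a map $P\times G\to G$, $(p,g)\mapsto g|_p$, such that for all $g,h\in G$, $p,q\in P$: $e\cdot p=p$; $(gh)\cdot p=g\cdot(h\cdot p)$; $g\cdot e=e$; $g|_e=g$; $g\cdot(pq)=(g\cdot p)(g|_p\cdot q)$; $g|_{pq}=(g|_p)|_q$; $e|_p=e$; $(gh)|_p=g|_{h\cdot p}\,h|_p$. Then $P\bowtie G=P\times G$ with product $(p,g)(q,h)=(p(g\cdot q),\,g|_q h)$ is a semigroup with identity $(e,e)$. Product system. An $\mathcal{A}$-correspondence is a right Hilbert $\mathcal{A}$-module with a left action of $\mathcal{A}$ by adjointable operators. A product system over a semigroup $P$ with coefficient $\mathcal{A}$ is $X=\bigsqcup_{p\in P}X_p$, with each $X_p$ an $\mathcal{A}$-correspondence, with an associative multiplication $X_p\times X_q\to X_{pq}$ such that (1) $X_e=\mathcal{A}$ as an $\mathcal{A}$-correspondence; (2) for all $p,q\in P$ the multiplication extends to a unitary $M_{p,q}:X_p\otimes X_q\to X_{pq}$ (interior tensor product over $\mathcal{A}$); (3) the left and right actions of $\mathcal{A}$ on $X_p$ coincide with the multiplications $X_e\times X_p\to X_p$ and $X_p\times X_e\to X_p$. Zappa-Szép action of $G$ on $X$: a collection $\beta=\{\beta_g\}_{g\in G}$ of maps on $X$ such that (A1) for each $p\in P$, $g\in G$, $\beta_g$ restricts to a $\mathbb{C}$-linear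 map $X_p\to X_{g\cdot p}$; (A2) $\beta_g\circ\beta_h=\beta_{gh}$; (A3) $\beta_e$ is the identity; (A4) each $\beta_g$ is a $*$-automorphism of $X_e=\mathcal{A}$; (A5) $\beta_g(xy)=\beta_g(x)\beta_{g|_p}(y)$ for $x\in X_p$, $y\in X_q$; (A6) $\langle\beta_g(x),\beta_g(y)\rangle=\beta_{g|_p}(\langle x,y\rangle)$ for $x,y\in X_p$. The triple $(X,G,\beta)$ is called a Zappa-Szép system. The product system $X\bowtie G$ over $P\bowtie G$ with coefficient $\mathcal{A}$: its fibre over $(p,g)$ is $Y_{(p,g)}=\{x\otimes g:x\in X_p\}$ with $a(x\otimes g)=ax\otimes g$, $(x\otimes g)a=x\beta_g(a)\otimes g$, $\langle x\otimes g,y\otimes g\rangle=\beta_{g^{-1}}(\langle x,y\rangle)$, and multiplication $(x\otimes g)(y\otimes h)=x\beta_g(y)\otimes g|_q h$ for $x\in X_p$, $y\in X_q$; $Y_{(e,e)}$ is identified with $\mathcal{A}$ via $a\otimes e\leftrightarrow a$. A (Toeplitz) representation of a product system $X$ over $P$ on a C*-algebra $\mathcal{B}$ is a family $\psi=(\psi_p)_{p\in P}$ of linear maps $\psi_p:X_p\to\mathcal{B}$ such that $\psi_e$ is a $*$-homomorphism, $\psi_p(x)\psi_q(y)=\psi_{pq}(xy)$ for $x\in X_p,y\in X_q$, and $\psi_p(x)^*\psi_p(y)=\psi_e(\langle x,y\rangle)$ for $x,y\in X_p$. A covariant representation of $(X,G,\beta)$ on a unital C*-algebra $\mathcal{B}$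 is a pair $(\psi,U)$ of a representation $\psi$ of $X$ on $\mathcal{B}$ and a unitary representation $U$ of $G$ on $\mathcal{B}$ with $U_g\psi_p(x)=\psi_{g\cdot p}(\beta_g(x))U_{g|_p}$ for all $p\in P$, $g\in G$, $x\in X_p$.
   Formalization: Representations are required to be unital on the coefficient algebra (ψ_e and Ψ_(e,e) send 1_A to 1_B); without this the claim fails, since for nonzero B the zero representation Ψ gives U_g = 0, which is not unitary. *)

(* Defs.v *)
From HB Require Import structures.
From mathcomp Require Import all_boot all_order all_algebra.
From mathcomp Require Import complex.
From mathcomp Require Import boolp classical_sets reals topology normedtype sequences.
From mathcomp Require Import ring lra.

Set Implicit Arguments.
Unset Strict Implicit.
Unset Printing Implicit Defensive.

Import Order.TTheory GRing.Theory Num.Theory.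
Import numFieldNormedType.Exports.

Local Open Scope classical_set_scope.
Local Open Scope complex_scope.
Local Open Scope ring_scope.

(* The product is part of the mixin because a structure joining pzRingType and
   normedModType cannot be declared above the existing numDomainType. *)
HB.mixin Record isCStarAlgebra (R : realType) A & CompleteNormedModule R[i] A := {
  cmul : A -> A -> A;
  cone : A;
  star : A -> A;
  cmulA : associative cmul;
  cmul1l : left_id cone cmul;
  cmul1r : right_id cone cmul;
  cmulDl : left_distributive cmul +%R;
  cmulDr : right_distributive cmul +%R;
  cmulZl : forall (k : R[i]) (x y : A), cmul (k *: x) y = k *: cmul x y;
  cmulZr : forall (k : R[i]) (x y : A), cmul x (k *: y) = k *: cmul x y;
  starK : involutive star;
  starD : {morph star : x y / x + y};
  starZ : forall (k : R[i]) (x : A), star (k *: x) = k^* *: star x;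
  starM : forall x y : A, star (cmul x y) = cmul (star y) (star x);
  cnormM : forall x y : A, `|cmul x y| <= `|x| * `|y|;
  cnorm_star : forall x : A, `|cmul (star x) x| = `|x| ^+ 2
}.

#[short(type="cstarAlgType")]
HB.structure Definition CStarAlgebra (R : realType) :=
  {A of CompleteNormedModule R[i] A & isCStarAlgebra R A}.

Declare Scope cstar_scope.
Delimit Scope cstar_scope with cs.
Local Open Scope cstar_scope.
Notation "a ** b" := (cmul a b) (at level 40, left associativity) : cstar_scope.

HB.mixin Record isHilbertModule (R : realType) (A : cstarAlgType R) E
    & CompleteNormedModule R[i] E := {
  ract : E -> A -> E;
  inner : E -> E -> A;
  ractDl : forall (x y : E) (a : A), ract (x + y) a = ract x a + ract y a;
  ractDr : forall (x : E) (a b : A), ract x (a + b) = ract x a + ract x b;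
  ractZl : forall (k : R[i]) (x : E) (a : A), ract (k *: x) a = k *: ract x a;
  ractZr : forall (k : R[i]) (x : E) (a : A), ract x (k *: a) = k *: ract x a;
  ractM : forall (x : E) (a b : A), ract x (a ** b) = ract (ract x a) b;
  ract1 : forall x : E, ract x cone = x;
  innerDr : forall x y z : E, inner x (y + z) = inner x y + inner x z;
  innerZr : forall (k : R[i]) (x y : E), inner x (k *: y) = k *: inner x y;
  inner_ract : forall (x y : E) (a : A), inner x (ract y a) = inner x y ** a;
  inner_star : forall x y : E, star (inner x y) = inner y x;
  inner_ge0 : forall x : E, exists c : A, inner x x = star c ** c;
  norm_inner : forall x : E, `|x| ^+ 2 = `|inner x x|
}.

#[short(type="hilbertModType")]
HB.structure Definition HilbertModule (R : realType) (A : cstarAlgType R) :=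
  {E of CompleteNormedModule R[i] E & isHilbertModule R A E}.

(* By lact_adj the operator lact a is adjointable, hence linear and right
   A-linear. *)
HB.mixin Record isCorrespondence (R : realType) (A : cstarAlgType R) E
    & HilbertModule R A E := {
  lact : A -> E -> E;
  lactD : forall (a b : A) (x : E), lact (a + b) x = lact a x + lact b x;
  lactZ : forall (k : R[i]) (a : A) (x : E), lact (k *: a) x = k *: lact a x;
  lactM : forall (a b : A) (x : E), lact (a ** b) x = lact a (lact b x);
  lact_adj : forall (a : A) (x y : E), inner (lact a x) y = inner x (lact (star a) y)
}.

#[short(type="correspondenceType")]
HB.structure Definition Correspondence (R : realType) (A : cstarAlgType R) :=
  {E of HilbertModule R A E & isCorrespondence R A E}.
Section NormR.
Context {R : realType}.
Implicit Types V : completeNormedModType R[i].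

Definition normR V (x : V) : R := complex.Re `|x|.

Lemma normRE V (x : V) : `|x| = (normR x)%:C.
Proof. by rewrite /normR RRe_real// ger0_real. Qed.

Lemma normR_ge0 V (x : V) : 0 <= normR x.
Proof. by have := normr_ge0 x; rewrite normRE lecR. Qed.

Lemma normRD V (x y : V) : normR (x + y) <= normR x + normR y.
Proof. by have := ler_normD x y; rewrite !normRE -rmorphD lecR. Qed.

Lemma normRN V (x : V) : normR (- x) = normR x.
Proof. by rewrite /normR normrN. Qed.

Lemma normRZ V (k : R) (x : V) : 0 <= k -> normR (k%:C *: x) = k * normR x.
Proof.
move=> k0; have := normrZ (k%:C) x; rewrite !normRE ger0_norm ?lecR//.
by rewrite -rmorphM => /(congr1 (@complex.Re R)).
Qed.

Lemma normR0_eq V (x : V) : normR x = 0 -> x = 0.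
Proof. by move=> x0; apply/eqP; rewrite -normr_eq0 normRE x0. Qed.

Lemma half_expn_small (x y : R) : 0 < x -> exists n, y * (1 / 2) ^+ n < x.
Proof.
move=> xp; have [y0|y0] := leP y 0.
  by exists 0%N; rewrite expr0 mulr1 (le_lt_trans y0).
have [n Hn] : exists n, y / x < n%:R.
  by exists (Num.bound (y / x)); rewrite archi_boundP// ltW// divr_gt0.
exists n; rewrite div1r exprVn ltr_pdivrMr ?exprn_gt0//.
rewrite mulrC -ltr_pdivrMr// (lt_le_trans Hn)// -natrX ler_nat ltnW//.
exact: ltn_expl.
Qed.

Lemma half_expn_eq0 (x y : R) : 0 <= x -> (forall n, x <= y * (1 / 2) ^+ n) -> x = 0.
Proof.
move=> x0 H; apply/eqP; rewrite eq_le x0 andbT leNgt; apply/negP => xp.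
by have [n Hn] := half_expn_small y xp; have := H n; rewrite leNgt Hn.
Qed.

Lemma half_cauchy V (u : nat -> V) :
  (forall n, normR (u n.+1 - u n) <= (1 / 2) ^+ n) ->
  exists l, forall n, normR (l - u n) <= 3 * (1 / 2) ^+ n.
Proof.
move=> Hu.
have Hm n m : normR (u (n + m)%N - u n) <= 2 * (1 / 2) ^+ n * (1 - (1 / 2) ^+ m).
  elim: m => [|m IH].
    by rewrite addn0 subrr expr0 subrr mulr0 /normR normr0.
  have -> : u (n + m.+1)%N - u n
      = (u (n + m).+1 - u (n + m)%N) + (u (n + m)%N - u n).
    by rewrite addnS addrA subrK.
  rewrite (le_trans (normRD _ _))// (le_trans (lerD (Hu _) IH))//.
  by rewrite exprD exprS; lra.
have half_ge0 n : 0 <= (1 / 2 : R) ^+ n by rewrite exprn_ge0//; lra.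
have Hle n m : (n <= m)%N -> normR (u m - u n) <= 2 * (1 / 2) ^+ n.
  move=> /subnKC <-; apply: le_trans (Hm _ _) _.
  have := half_ge0 n; have := half_ge0 (m - n)%N; nra.
have cu : cvg (u @ \oo).
  apply/cauchy_cvgP/cauchy_ballP => e e0.
  have eE : e = (complex.Re e)%:C by rewrite RRe_real// ger0_real// ltW.
  move: e0; rewrite eE ltcR => e0.
  have [N HN] := half_expn_small 4 e0.
  near_simpl; exists ([set n | (N <= n)%N], [set n | (N <= n)%N]); first by split; exists N.
  move=> [n m] /= [Nn Nm].
  rewrite -ball_normE /= normRE ltcR (le_lt_trans _ HN)//.
  have -> : u n - u m = (u n - u N) + (- (u m - u N)) by rewrite opprB addrA subrK.
  rewrite (le_trans (normRD _ _))// normRN (le_trans (lerD (Hle _ _ Nn) (Hle _ _ Nm)))//.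
  lra.
exists (lim (u @ \oo)) => n.
have hp : 0 < ((1 / 2 : R) ^+ n)%:C by rewrite ltcR exprn_gt0//; lra.
have /cvgrPdist_le /(_ _ hp) [N _ HN] := cu.
have := HN (maxn N n) (leq_maxl _ _); rewrite normRE lecR => H.
have := Hle n (maxn N n) (leq_maxr _ _) => H2.
have -> : lim (u @ \oo) - u n
   = (lim (u @ \oo) - u (maxn N n)) + (u (maxn N n) - u n) by rewrite addrA subrK.
rewrite (le_trans (normRD _ _))//; lra.
Qed.
End NormR.
(* Unital, as the C*-algebras under consideration are.  Unitality cannot be
   dropped for representations: the zero representation of a product system
   would send 1 (x) g to 0, which is not a unitary. *)
Definition star_hom (R : realType) (A B : cstarAlgType R) (f : A -> B) : Prop :=
  [/\ linear f, {morph f : x y / x ** y}, {morph f : x / star x} & f cone = cone].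

Section CStarTheory.
Context {R : realType} {A : cstarAlgType R}.
Implicit Types x y a : A.

Lemma cmul0l x : 0 ** x = 0.
Proof. by rewrite -[0 in LHS](scale0r (0 : A)) cmulZl scale0r. Qed.
Lemma cmul0r x : x ** 0 = 0.
Proof. by rewrite -[0 in LHS](scale0r (0 : A)) cmulZr scale0r. Qed.
Lemma cmulNl x y : (- x) ** y = - (x ** y).
Proof. by rewrite -scaleN1r cmulZl scaleN1r. Qed.
Lemma cmulNr x y : x ** (- y) = - (x ** y).
Proof. by rewrite -scaleN1r cmulZr scaleN1r. Qed.
Lemma cmulBl x y z : (x - y) ** z = x ** z - y ** z.
Proof. by rewrite cmulDl cmulNl. Qed.
Lemma cmulBr x y z : x ** (y - z) = x ** y - x ** z.
Proof. by rewrite cmulDr cmulNr. Qed.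
Lemma star0 : star (0 : A) = 0.
Proof. by apply: (addrI (star 0)); rewrite -starD !addr0. Qed.
Lemma starN x : star (- x) = - star x.
Proof. by apply: (addrI (star x)); rewrite -starD !subrr star0. Qed.
Lemma starB x y : star (x - y) = star x - star y.
Proof. by rewrite starD starN. Qed.
Lemma star1 : star (cone : A) = cone.
Proof. by rewrite -[LHS]cmul1l -[X in X ** _]starK -starM cmul1l starK. Qed.
Lemma starZR (k : R) x : star (k%:C *: x) = k%:C *: star x.
Proof. by rewrite starZ conj_Creal// realE -(rmorph0 (real_complex R)) !lecR -realE num_real. Qed.

Lemma normRM x y : normR (x ** y) <= normR x * normR y.
Proof. by have := cnormM x y; rewrite !normRE -rmorphM lecR. Qed.

Lemma normR_star2 x : normR (star x ** x) = normR x ^+ 2.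
Proof.
by have := cnorm_star x; rewrite !normRE -rmorphXn => /(congr1 (@complex.Re R)).
Qed.

Lemma normR_star x : normR (star x) = normR x.
Proof.
have H (z : A) : normR z <= normR (star z).
  have := normR_star2 z; have := normRM (star z) z.
  have := normR_ge0 z; have := normR_ge0 (star z); nra.
by apply/eqP; rewrite eq_le H -{2}[x]starK H.
Qed.

Lemma normR_isometry x : star x ** x = cone -> normR x <= 1.
Proof.
move=> ux; have := normR_star2 x; rewrite ux.
have := normR_star2 (cone : A); rewrite cmul1r star1.
move=> c2 cx; have c1 : normR (cone : A) <= 1 by nra.
have := normR_ge0 x; nra.
Qed.

Lemma half_scaleK x : (1 / 2 : R)%:C *: (x + x) = x.
Proof.
rewrite scalerDr -scalerDl -rmorphD (_ : _ + _ = 1) ?rmorph1 ?scale1r//; lra.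
Qed.

Lemma quadratic_root a : star a = a -> normR a <= 1 / 2 ->
  exists y, [/\ star y = y, y ** a = a ** y & y + y = a ** a + y ** y].
Proof.
move=> sa na; pose h : R[i] := (1 / 2 : R)%:C.
pose F y := h *: (a ** a + y ** y).
pose u n := iter n F 0.
have naa : normR (a ** a) <= 1 / 4.
  by have := normRM a a; have := normR_ge0 a; nra.
have nF (y : A) : normR y <= 1 / 2 -> normR (F y) <= 1 / 2.
  move=> ny; rewrite normRZ; last lra.
  have := normRD (a ** a) (y ** y); have := normRM y y.
  by have := normR_ge0 y; nra.
have LF (y z : A) : normR y <= 1 / 2 -> normR z <= 1 / 2 ->
    normR (F y - F z) <= 1 / 2 * normR (y - z).
  move=> ny nz; rewrite /F -scalerBr normRZ; last lra.
  have -> : a ** a + y ** y - (a ** a + z ** z) = y ** (y - z) + (y - z) ** z.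
    by rewrite cmulBr cmulBl addrA subrK opprD addrACA subrr add0r.
  have := normRD (y ** (y - z)) ((y - z) ** z).
  have := normRM y (y - z); have := normRM (y - z) z.
  have := normR_ge0 (y - z); have := normR_ge0 y; have := normR_ge0 z; nra.
have nu n : normR (u n) <= 1 / 2.
  elim: n => [|n IH]; last exact: nF.
  by rewrite /u /= /normR normr0; lra.
have su n : star (u n) = u n.
  elim: n => [|n IH]; first exact: star0.
  by rewrite /u /= -/(u n) /F starZR starD !starM sa IH.
have cu n : u n ** a = a ** u n.
  elim: n => [|n IH]; first by rewrite cmul0l cmul0r.
  rewrite /u /= -/(u n) /F cmulZl cmulZr cmulDl cmulDr; congr (_ *: (_ + _)).
    by rewrite cmulA.
  by rewrite -cmulA IH cmulA IH cmulA.
have du n : normR (u n.+1 - u n) <= (1 / 2) ^+ n.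
  elim: n => [|n IH].
    have := nF _ (nu 0%N); rewrite subr0 expr0 -[F (u 0%N)]/(u 1%N); lra.
  have := LF _ _ (nu n.+1) (nu n); rewrite exprS -[F (u n.+1)]/(u n.+2).
  rewrite -[F (u n)]/(u n.+1); lra.
have [y Hy] := half_cauchy du.
have zero (z : A) (K : R) : (forall n, normR z <= K * (1 / 2) ^+ n) -> z = 0.
  by move=> H; apply: normR0_eq; apply: half_expn_eq0 H; exact: normR_ge0.
have ny : normR y <= 4.
  have := Hy 0%N; have := nu 0%N; have := normRD (y - u 0%N) (u 0%N).
  rewrite subrK expr0; lra.
exists y; split.
- apply/eqP; rewrite -subr_eq0; apply/eqP; apply: (zero _ 6) => n.
  have -> : star y - y = star (y - u n) + (- (y - u n)).
    by rewrite starB su opprB addrA subrK.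
  rewrite (le_trans (normRD _ _))// normRN normR_star.
  have := Hy n; lra.
- apply/eqP; rewrite -subr_eq0; apply/eqP; apply: (zero _ 6) => n.
  have -> : y ** a - a ** y = (y - u n) ** a + (- (a ** (y - u n))).
    by rewrite cmulBl cmulBr cu opprB addrA subrK.
  rewrite (le_trans (normRD _ _))// normRN.
  have := normRM a (y - u n); have := normRM (y - u n) a.
  have := normR_ge0 a; have := normR_ge0 (y - u n); have := Hy n; nra.
- suff yF : y = F y by rewrite -[RHS]half_scaleK scalerDr -/h -[_ *: _]/(F y) -yF.
  apply/eqP; rewrite -subr_eq0; apply/eqP; apply: (zero _ 12) => n.
  have -> : y - F y = (y - u n.+1) + (u n.+1 - F y) by rewrite addrA subrK.
  rewrite (le_trans (normRD _ _))//.
  have H1 := Hy n.+1.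
  have H2 : normR (u n.+1 - F y) <= 9 / 4 * normR (y - u n).
    rewrite /u /= -/(u n) /F -scalerBr normRZ; last lra.
    have -> : a ** a + u n ** u n - (a ** a + y ** y)
        = - (u n ** (y - u n) + (y - u n) ** y).
      rewrite cmulBr cmulBl [u n ** y - _ + _]addrC addrA subrK opprB.
      by rewrite opprD addrACA subrr add0r.
    rewrite normRN.
    have := normRD (u n ** (y - u n)) ((y - u n) ** y).
    have := normRM (u n) (y - u n); have := normRM (y - u n) y.
    have d0 := normR_ge0 (y - u n).
    have := ler_wpM2r d0 (nu n); have := ler_wpM2l d0 ny.
    lra.
  have q0 : 0 <= (1 / 2 : R) ^+ n by rewrite exprn_ge0//; lra.
  by rewrite exprS in H1; have := Hy n; lra.
Qed.

Lemma unitary_half a : star a = a -> normR a <= 1 / 2 ->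
  exists u, star u ** u = cone /\ a + a = u + star u.
Proof.
move=> sa na; have [y [sy ya yy]] := quadratic_root sa na.
pose b := cone - y.
have sb : star b = b by rewrite starB star1 sy.
have ab : a ** b = b ** a by rewrite cmulBl cmulBr cmul1l cmul1r ya.
have bb : b ** b = cone - a ** a.
  rewrite cmulBl !cmulBr !cmul1l !cmul1r opprB -addrA [- y + _]addrCA -opprD yy.
  by rewrite [_ + y ** y]addrC opprD [y ** y + _]addrA subrr add0r.
exists (a + 'i *: b).
have su : star (a + 'i *: b) = a - 'i *: b.
  by rewrite starD starZ sa sb conjCi scaleNr.
rewrite su; split; last by rewrite addrACA subrr addr0.
rewrite cmulBl !cmulDr !cmulZl !cmulZr ab scalerA -expr2 sqrCi scaleN1r bb.
by rewrite opprB addrACA subrr addr0 addrC subrK.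
Qed.

End CStarTheory.

(* A star-homomorphism f is contractive: a self-adjoint a of norm at most 1/2 is
   the mean of a unitary and its adjoint, which bounds f a; the constant is then
   improved by taking powers a ^ (2 ^ n). *)
Section StarHom.
Context {R : realType} {A B : cstarAlgType R} (f : A -> B).
Hypothesis fh : star_hom f.

Let flin : linear f. Proof. by case: fh. Qed.
Let fM : {morph f : x y / x ** y}. Proof. by case: fh. Qed.
Let fS : {morph f : x / star x}. Proof. by case: fh. Qed.
Let f1 : f cone = cone. Proof. by case: fh. Qed.
Let fD : {morph f : x y / x + y}.
Proof. by move=> x y; rewrite -[x]scale1r flin !scale1r. Qed.
Let f0 : f 0 = 0.
Proof. by apply: (addrI (f 0)); rewrite -fD !addr0. Qed.
Let fZ k x : f (k *: x) = k *: f x.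
Proof. by rewrite -[k *: x]addr0 flin f0 addr0. Qed.

Let le_half a : star a = a -> normR a <= 1 / 2 -> normR (f a) <= 1.
Proof.
move=> sa na; have [u [uu aE]] := unitary_half sa na.
have : normR (f u) <= 1 by apply: normR_isometry; rewrite -fS -fM uu f1.
have : normR (f a + f a) <= normR (f u) + normR (f u).
  by rewrite -fD aE fD (le_trans (normRD _ _))// fS normR_star.
rewrite -[f a in X in _ -> _ -> X]half_scaleK normRZ; lra.
Qed.

Let le_two a : star a = a -> normR (f a) <= 2 * normR a.
Proof.
move=> sa; have := normR_ge0 a; rewrite le_eqVlt => /predU1P[/esym a0|a0].
  by rewrite (normR0_eq a0) f0 /normR !normr0; lra.
pose t := 1 / (2 * normR a).
have t0 : 0 < t by rewrite divr_gt0//; lra.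
have ta : t * normR a = 1 / 2 by rewrite /t; field; rewrite gt_eqF.
have nt : normR (t%:C *: a) <= 1 / 2 by rewrite normRZ ?(ltW t0)// ta.
have /le_half/(_ nt) : star (t%:C *: a) = t%:C *: a by rewrite starZR sa.
rewrite fZ normRZ ?(ltW t0)// /t mul1r ler_pdivrMl ?mulr1//; lra.
Qed.

Let le_sa a : star a = a -> normR (f a) <= normR a.
Proof.
move=> sa.
pose p n (C : cstarAlgType R) (x : C) := iter n (fun z => z ** z) x.
have sp n (C : cstarAlgType R) (x : C) : star x = x -> star (p n C x) = p n C x.
  by move=> sx; elim: n => //= n IH; rewrite starM IH.
have np n (C : cstarAlgType R) (x : C) : star x = x ->
    normR (p n C x) = normR x ^+ (2 ^ n).
  move=> sx; elim: n => [|n IH]; first by rewrite expn0 expr1.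
  by rewrite expnSr exprM -IH -normR_star2 (sp n C x sx).
have fp n : f (p n A a) = p n B (f a) by elim: n => //= n IH; rewrite fM IH.
have H n : normR (f a) ^+ (2 ^ n) <= 2 * normR a ^+ (2 ^ n).
  by rewrite -!np -?fS ?sa// -fp; apply: le_two; exact: sp.
rewrite leNgt; apply/negP => lt.
have a0 : 0 < normR a.
  rewrite lt_neqAle normR_ge0 andbT; apply/eqP => a0.
  by have := H 0%N; move: lt; rewrite expn0 !expr1; lra.
pose d := normR (f a) / normR a - 1.
have fE : normR (f a) = normR a * (1 + d) by rewrite /d; field; rewrite gt_eqF.
have d0 : 0 < d by rewrite /d subr_gt0 ltr_pdivlMr// mul1r.
have bern n : 1 + n%:R * d <= (1 + d) ^+ n.
  elim: n => [|n IH]; first by rewrite mul0r addr0 expr0.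
  rewrite exprS -natr1; have := ler0n R n; nra.
have H2 n : n%:R <= 1 / d.
  rewrite ler_pdivlMr//; have := H n; rewrite fE exprMn mulrC.
  have apos : 0 < normR a ^+ (2 ^ n) by rewrite exprn_gt0.
  rewrite ler_pM2r// => Hn; have := bern (2 ^ n)%N.
  have : (n%:R : R) <= (2 ^ n)%:R by rewrite ler_nat ltnW// ltn_expl.
  nra.
have := H2 (Num.bound (1 / d)); apply/negP; rewrite -ltNge.
by rewrite archi_boundP// ltW// divr_gt0.
Qed.

Lemma star_hom_le a : normR (f a) <= normR a.
Proof.
rewrite -(@ler_pXn2r _ 2)// ?nnegrE ?normR_ge0//.
by rewrite -!normR_star2 -fS -fM; apply: le_sa; rewrite starM starK.
Qed.

End StarHom.


Record zappa_szep (P : monoidType) (G : groupType) := ZappaSzep {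
  zact : G -> P -> P;
  zres : P -> G -> G;
  zact1 : forall p, zact 1%g p = p;
  zactM : forall g h p, zact (g * h)%g p = zact g (zact h p);
  zact_id : forall g, zact g 1%g = 1%g;
  zres_id : forall g, zres 1%g g = g;
  zact_mul : forall g p q, zact g (p * q)%g = (zact g p * zact (zres p g) q)%g;
  zres_mul : forall g p q, zres (p * q)%g g = zres q (zres p g);
  zres1 : forall p, zres p 1%g = 1%g;
  zresM : forall g h p, zres p (g * h)%g = (zres (zact h p) g * zres p h)%g
}.

Definition zs_prod (P : monoidType) (G : groupType) (Z : zappa_szep P G) : Type :=
  (P * G)%type.

Section ZSProd.
Context {P : monoidType} {G : groupType} (Z : zappa_szep P G).

HB.instance Definition _ := Choice.copy (zs_prod Z) (P * G)%type.

Definition zs_mul (u v : zs_prod Z) : zs_prod Z :=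
  ((u.1 * zact Z u.2 v.1)%g, (zres Z v.1 u.2 * v.2)%g).

Definition zs_one : zs_prod Z := (1%g, 1%g).

Lemma zs_mulA : associative zs_mul.
Proof.
move=> [p g] [q h] [r k]; rewrite /zs_mul /=; congr pair.
  by rewrite zact_mul zactM mulgA.
by rewrite zres_mul zresM mulgA.
Qed.

Lemma zs_mul1l : left_id zs_one zs_mul.
Proof.
by move=> [p g]; rewrite /zs_mul /= zact1 zres1 !mul1g.
Qed.

Lemma zs_mul1r : right_id zs_one zs_mul.
Proof.
by move=> [p g]; rewrite /zs_mul /= zact_id zres_id !mulg1.
Qed.

HB.instance Definition _ :=
  isMonoid.Build (zs_prod Z) zs_mulA zs_mul1l zs_mul1r.

End ZSProd.

Section HilbertModuleMaps.
Context {R : realType} {A : cstarAlgType R}.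

Definition unitary_map (E F : hilbertModType A) (M : E -> F) : Prop :=
  exists M' : F -> E, [/\ forall x y, inner (M x) y = inner x (M' y),
                          cancel M M' & cancel M' M].

(* (T, tau) is a realization of the interior tensor product of E and F over A:
   the completion, for the inner product displayed below, of the span of the
   elementary tensors tau x y; it is unique up to a unique unitary. *)
Definition interior_tensor (E : hilbertModType A) (F : correspondenceType A)
    (T : hilbertModType A) (tau : E -> F -> T) : Prop :=
  [/\ (forall x, linear (tau x)) /\ (forall y, linear (tau^~ y)),
      forall x a y, tau (ract x a) y = tau x (lact a y),
      forall x y a, tau x (ract y a) = ract (tau x y) a,
      forall x y x' y',
        inner (tau x y) (tau x' y') = inner y (lact (inner x x') y') &
      closure [set t | exists s : seq (E * F), t = \sum_(z <- s) tau z.1 z.2]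
        = setT].

Definition extends_to_unitary (E : hilbertModType A) (F : correspondenceType A)
    (Z : hilbertModType A) (m : E -> F -> Z) : Prop :=
  exists (T : hilbertModType A) (tau : E -> F -> T) (M : T -> Z),
    [/\ interior_tensor tau, unitary_map M & forall x y, M (tau x y) = m x y].

End HilbertModuleMaps.

(* The image of x in the disjoint union of the fibres; equalities between
   elements of fibres over propositionally equal indices are stated there. *)
Definition tot (R : realType) (A : cstarAlgType R) (P : Type)
    (X : P -> correspondenceType A) (p : P) (x : X p) : {q : P & X q} :=
  existT (fun q => X q : Type) p x.

(* The equality of A with the fibre over the identity is an isomorphism of
   correspondences ps1. *)
Record product_system (R : realType) (A : cstarAlgType R) (P : monoidType) :=
    ProductSystem {
  fiber :> P -> correspondenceType A;
  psmul : forall p q, fiber p -> fiber q -> fiber (p * q)%g;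
  ps1 : A -> fiber 1%g;
  ps1_inv : fiber 1%g -> A;
  psmulA : forall p q r (x : fiber p) (y : fiber q) (z : fiber r),
    tot (psmul x (psmul y z)) = tot (psmul (psmul x y) z);
  ps1K : cancel ps1 ps1_inv;
  ps1_invK : cancel ps1_inv ps1;
  ps1_linear : linear ps1;
  ps1_lact : forall a b, ps1 (a ** b) = lact a (ps1 b);
  ps1_ract : forall a b, ps1 (a ** b) = ract (ps1 a) b;
  ps1_inner : forall a b, inner (ps1 a) (ps1 b) = star a ** b;
  psmul_unitary : forall p q, extends_to_unitary (@psmul p q);
  psmul_lact : forall p a (x : fiber p), tot (psmul (ps1 a) x) = tot (lact a x);
  psmul_ract : forall p a (x : fiber p), tot (psmul x (ps1 a)) = tot (ract x a)
}.

Arguments psmul {R A P} _ {p q}.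

Section ZSAction.
Context {R : realType} {A : cstarAlgType R} {P : monoidType} {G : groupType}.
Context (Z : zappa_szep P G) (X : product_system A P).

(* The restriction of beta g to the fibre over the identity, read on A; it is
   well typed because g fixes the identity of P. *)
Definition zcoef_map (beta : forall g p, X p -> X (zact Z g p)) (g : G) (a : A) : A :=
  ps1_inv (ecast p (X p) (zact_id Z g) (beta g 1%g (ps1 X a))).

Record zs_action := ZSAction {
  zbeta : forall g p, X p -> X (zact Z g p);
  zbeta_linear : forall g p, linear (@zbeta g p);
  zbetaM : forall g h p (x : X p), tot (zbeta g (zbeta h x)) = tot (zbeta (g * h)%g x);
  zbeta1 : forall p (x : X p), tot (zbeta 1%g x) = tot x;
  zbeta_aut : forall g, star_hom (zcoef_map zbeta g) /\ bijective (zcoef_map zbeta g);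
  zbeta_mul : forall g p q (x : X p) (y : X q),
    tot (zbeta g (psmul X x y)) = tot (psmul X (zbeta g x) (zbeta (zres Z p g) y));
  zbeta_inner : forall g p (x y : X p),
    inner (zbeta g x) (zbeta g y) = zcoef_map zbeta (zres Z p g) (inner x y)
}.

End ZSAction.
Arguments zbeta {R A P G Z X} _ g {p}.

Definition zcoef {R : realType} {A : cstarAlgType R} {P : monoidType}
    {G : groupType} {Z : zappa_szep P G} {X : product_system A P}
    (beta : zs_action Z X) : G -> A -> A :=
  zcoef_map (@zbeta _ _ _ _ _ _ beta).

Section Tot.
Context {R : realType} {A : cstarAlgType R} {P : choiceType}.
Context {X : P -> correspondenceType A}.

Lemma totP p q (x : X p) (y : X q) : tot x = tot y ->
  exists e : p = q, ecast r (X r) e x = y.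
Proof.
rewrite /tot => H; have e : p = q by case: H.
exists e; case: _ / e y H => y H /=.
have /(_ _ (fun r => X r : Type)) inj := @Eqdep_dec.inj_pair2_eq_dec P.
by apply: inj H => u v; exact: pselect.
Qed.

Lemma tot_inj p (x y : X p) : tot x = tot y -> x = y.
Proof. by case/totP => e; rewrite (Prop_irrelevance e erefl). Qed.

Lemma tot_cast p q (e : p = q) (x : X p) : tot (ecast r (X r) e x) = tot x.
Proof. by case: _ / e. Qed.

Lemma tot_ract p q (x : X p) (y : X q) a : tot x = tot y ->
  tot (ract x a) = tot (ract y a).
Proof. by case/totP => e; case: _ / e y => y <-. Qed.

Lemma tot_lact p q (x : X p) (y : X q) a : tot x = tot y ->
  tot (lact a x) = tot (lact a y).
Proof. by case/totP => e; case: _ / e y => y <-. Qed.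

Lemma tot_inner p q (x x' : X p) (y y' : X q) : tot x = tot y -> tot x' = tot y' ->
  inner x x' = inner y y'.
Proof.
by case/totP => e; case: _ / e y y' => y y' /= <- /tot_inj <-.
Qed.

End Tot.

Section HilbertTheory.
Context {R : realType} {A : cstarAlgType R}.
Implicit Types E F T : hilbertModType A.

Lemma linear_add (V W : lmodType R[i]) (f : V -> W) : linear f ->
  {morph f : x y / x + y}.
Proof. by move=> fl x y; rewrite -[x]scale1r fl !scale1r. Qed.

Lemma linear_zero (V W : lmodType R[i]) (f : V -> W) : linear f -> f 0 = 0.
Proof. by move=> fl; apply: (addrI (f 0)); rewrite -linear_add// !addr0. Qed.

Lemma linear_scale (V W : lmodType R[i]) (f : V -> W) : linear f ->
  forall k x, f (k *: x) = k *: f x.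
Proof. by move=> fl k x; rewrite -[k *: x]addr0 fl linear_zero// addr0. Qed.

Lemma linear_sub (V W : lmodType R[i]) (f : V -> W) : linear f ->
  {morph f : x y / x - y}.
Proof.
by move=> fl x y; rewrite linear_add// -scaleN1r linear_scale// scaleN1r.
Qed.

Lemma linear_big (V W : lmodType R[i]) (f : V -> W) (I : Type) (s : seq I) (t : I -> V) :
  linear f -> f (\sum_(i <- s) t i) = \sum_(i <- s) f (t i).
Proof.
move=> fl; elim: s => [|i s IH]; first by rewrite !big_nil linear_zero.
by rewrite !big_cons linear_add// IH.
Qed.

Lemma inner_linear E (x : E) : linear (inner x).
Proof. by move=> k y z; rewrite innerDr innerZr. Qed.

Lemma normR_inner E (x : E) : normR x ^+ 2 = normR (inner x x).
Proof.
by have := norm_inner x; rewrite !normRE -rmorphXn => /(congr1 (@complex.Re R)).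
Qed.

Lemma inner_ext E (x y : E) : (forall z, inner z x = inner z y) -> x = y.
Proof.
move=> H; apply/eqP; rewrite -subr_eq0; apply/eqP/normR0_eq/eqP.
rewrite -sqrf_eq0 normR_inner [inner _ (_ - _)](linear_sub (inner_linear _)).
by rewrite H subrr /normR normr0.
Qed.

Lemma adjoint_linear E F (f : E -> F) (g : F -> E) :
  (forall x y, inner (f x) y = inner x (g y)) -> linear f.
Proof.
move=> fg k x y; apply: inner_ext => z.
have gf u v : inner v (f u) = inner (g v) u.
  by rewrite -[LHS]inner_star fg inner_star.
by rewrite gf innerDr innerZr !inner_linear !gf.
Qed.

Lemma adjoint_ract E F (f : E -> F) (g : F -> E) :
  (forall x y, inner (f x) y = inner x (g y)) ->
  forall x a, f (ract x a) = ract (f x) a.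
Proof.
move=> fg x a; apply: inner_ext => z.
have gf u v : inner v (f u) = inner (g v) u.
  by rewrite -[LHS]inner_star fg inner_star.
by rewrite gf !inner_ract gf.
Qed.

Lemma unitary_mapP E F (M : E -> F) : unitary_map M ->
  [/\ linear M, forall x a, M (ract x a) = ract (M x) a,
      forall x y, inner (M x) (M y) = inner x y,
      forall x, normR (M x) = normR x & forall y, exists x, M x = y].
Proof.
case=> M' [adj MK M'K].
have isom x y : inner (M x) (M y) = inner x y by rewrite adj MK.
split=> // [||x|y]; [exact: adjoint_linear adj|exact: adjoint_ract adj| |].
  apply/eqP; rewrite -(@eqrXn2 _ 2) ?normR_ge0//.
  by rewrite !normR_inner isom.
by exists (M' y).
Qed.

Lemma closure_setTP (V : completeNormedModType R[i]) (S : set V) :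
  closure S = setT <->
  forall v (e : R), 0 < e -> exists2 w, S w & normR (v - w) < e.
Proof.
split=> [cl v e e0|H].
  have : closure S v by rewrite cl.
  have e0' : 0 < e%:C by rewrite ltcR.
  move/(_ (ball v e%:C) (nbhsx_ballx _ _ e0')) => [w [Sw]].
  by rewrite -ball_normE /= normRE ltcR; exists w.
apply/seteqP; split=> // v _ B /nbhs_ballP[e /= e0 eB].
have eE : e = (complex.Re e)%:C by rewrite RRe_real// ger0_real// ltW.
move: e0; rewrite eE ltcR => /(H v)[w Sw vw].
by exists w; split=> //; apply: eB; rewrite -ball_normE /= normRE eE ltcR.
Qed.

End HilbertTheory.

Section ProductSystemTheory.
Context {R : realType} {A : cstarAlgType R} {P : monoidType}.
Context (X : product_system A P).

Lemma tot_psmul p q p' q' (x : X p) (y : X q) (x' : X p') (y' : X q') :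
  tot x = tot x' -> tot y = tot y' -> tot (psmul X x y) = tot (psmul X x' y').
Proof.
case/totP => e; case: _ / e x' => x' /= <-.
by case/totP => e; case: _ / e y' => y' /= <-.
Qed.

Lemma psmul_facts p q :
  [/\ (forall x, linear (@psmul _ _ _ X p q x)) /\
      (forall y, linear (fun x => @psmul _ _ _ X p q x y)),
      forall (x : X p) (y : X q) (x' : X p) (y' : X q),
        inner (psmul X x y) (psmul X x' y') = inner y (lact (inner x x') y')
    & forall (v : X (p * q)%g) (e : R), 0 < e ->
        exists s : seq (X p * X q),
          normR (v - \sum_(z <- s) psmul X z.1 z.2) < e].
Proof.
have [T [tau [M [[[lt lt'] _ _ it /closure_setTP dt] uM Mtau]]]] := psmul_unitary X p q.
have [lM rM iM nM sM] := unitary_mapP uM.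
split; first split.
- by move=> x k y y'; rewrite -!Mtau lt lM.
- by move=> y k x x'; rewrite -!Mtau (lt' y) lM.
- by move=> x y x' y'; rewrite -!Mtau iM it.
- move=> v e e0; have [t Mt] := sM v.
  have [w [s ->] tw] := dt t e e0.
  exists s; rewrite -Mt (_ : \sum_(z <- s) _ = M (\sum_(z <- s) tau z.1 z.2)).
    by rewrite -linear_sub// nM.
  by rewrite linear_big//; apply: eq_bigr => z _; rewrite Mtau.
Qed.

Lemma psmul_balanced p q (x : X p) a (y : X q) :
  tot (psmul X (ract x a) y) = tot (psmul X x (lact a y)).
Proof.
rewrite (tot_psmul (esym (psmul_ract a x)) (erefl (tot y))).
by rewrite -psmulA (tot_psmul (erefl (tot x)) (psmul_lact a y)).
Qed.

Lemma psmul_ractr p q (x : X p) a (y : X q) :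
  psmul X x (ract y a) = ract (psmul X x y) a.
Proof.
apply: tot_inj; rewrite -psmul_ract -psmulA.
by apply: tot_psmul => //; rewrite psmul_ract.
Qed.

Lemma psmul_lactl p q (x : X p) a (y : X q) :
  psmul X (lact a x) y = lact a (psmul X x y).
Proof.
apply: tot_inj; rewrite -psmul_lact psmulA.
by apply: tot_psmul => //; rewrite psmul_lact.
Qed.

End ProductSystemTheory.

Section ActionTheory.
Context {R : realType} {A : cstarAlgType R} {P : monoidType} {G : groupType}.
Context {Z : zappa_szep P G} {X : product_system A P} (beta : zs_action Z X).

Lemma tot_zbeta g p q (x : X p) (y : X q) : tot x = tot y ->
  tot (zbeta beta g x) = tot (zbeta beta g y).
Proof. by case/totP => e; case: _ / e y => y /= <-. Qed.

Lemma tot_zcoef g a : tot (ps1 X (zcoef beta g a)) = tot (zbeta beta g (ps1 X a)).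
Proof. by rewrite /zcoef /zcoef_map ps1_invK tot_cast. Qed.

Lemma ps1_inj : injective (ps1 X).
Proof. exact: can_inj (ps1K X). Qed.

Lemma zcoefM g h a : zcoef beta g (zcoef beta h a) = zcoef beta (g * h)%g a.
Proof.
apply: ps1_inj; apply: tot_inj; rewrite !tot_zcoef.
by rewrite (tot_zbeta _ (tot_zcoef _ _)) zbetaM.
Qed.

Lemma zcoef1 a : zcoef beta 1%g a = a.
Proof. by apply: ps1_inj; apply: tot_inj; rewrite tot_zcoef zbeta1. Qed.

Lemma zcoefK g : cancel (zcoef beta g) (zcoef beta g^-1%g).
Proof. by move=> a; rewrite zcoefM mulVg zcoef1. Qed.

Lemma zcoefVK g : cancel (zcoef beta g^-1%g) (zcoef beta g).
Proof. by move=> a; rewrite zcoefM mulgV zcoef1. Qed.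

Lemma zcoef_hom g : star_hom (zcoef beta g).
Proof. by case: (zbeta_aut beta g). Qed.

Lemma zcoef_lin g : linear (zcoef beta g). Proof. by case: (zcoef_hom g). Qed.
Lemma zcoef_mul g : {morph zcoef beta g : a b / a ** b}.
Proof. by case: (zcoef_hom g). Qed.
Lemma zcoef_star g : {morph zcoef beta g : a / star a}.
Proof. by case: (zcoef_hom g). Qed.
Lemma zcoef_one g : zcoef beta g cone = cone.
Proof. by case: (zcoef_hom g). Qed.

Lemma normR_zcoef g a : normR (zcoef beta g a) = normR a.
Proof.
apply/eqP; rewrite eq_le (star_hom_le (zcoef_hom g))/=.
by rewrite -{1}[a](zcoefK g) (star_hom_le (zcoef_hom _)).
Qed.

Lemma zbeta_lact g p a (x : X p) :
  zbeta beta g (lact a x) = lact (zcoef beta g a) (zbeta beta g x).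
Proof.
apply: tot_inj; rewrite -psmul_lact (tot_psmul (tot_zcoef g a) (erefl _)).
rewrite -(tot_zbeta g (psmul_lact a x)) zbeta_mul zres_id.
by [].
Qed.

Lemma zbeta_ract g p a (x : X p) :
  zbeta beta g (ract x a) = ract (zbeta beta g x) (zcoef beta (zres Z p g) a).
Proof.
apply: tot_inj; rewrite -psmul_ract (tot_psmul (erefl _) (tot_zcoef _ a)).
by rewrite -(tot_zbeta g (psmul_ract a x)) zbeta_mul.
Qed.

Lemma zbeta_surj g p (y : X (zact Z g p)) : exists x : X p, zbeta beta g x = y.
Proof.
have e : zact Z g^-1%g (zact Z g p) = p by rewrite -zactM mulVg zact1.
exists (ecast q (X q) e (zbeta beta g^-1%g y)); apply: tot_inj.
by rewrite (tot_zbeta g (tot_cast _ _)) zbetaM mulgV zbeta1.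
Qed.

End ActionTheory.

Section ZSFiber.
Context {R : realType} {A : cstarAlgType R} {P : monoidType} {G : groupType}.
Context {Z : zappa_szep P G} {X : product_system A P} (beta : zs_action Z X).

(* The fibre over (p, g), whose elements x (x) g are represented by x : X p. *)
Definition zs_fiber (u : zs_prod Z) : Type := X u.1.

Variable u : zs_prod Z.

HB.instance Definition _ := CompleteNormedModule.copy (zs_fiber u) (X u.1).

Definition zs_ract (x : zs_fiber u) (a : A) : zs_fiber u :=
  @ract R A (X u.1) x (zcoef beta u.2 a).
Definition zs_inner (x y : zs_fiber u) : A :=
  zcoef beta u.2^-1%g (@inner R A (X u.1) x y).
Definition zs_lact (a : A) (x : zs_fiber u) : zs_fiber u :=
  @lact R A (X u.1) a x.

Lemma zs_ractDl (x y : zs_fiber u) a : zs_ract (x + y) a = zs_ract x a + zs_ract y a.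
Proof. exact: ractDl. Qed.
Lemma zs_ractDr (x : zs_fiber u) a b : zs_ract x (a + b) = zs_ract x a + zs_ract x b.
Proof. by rewrite /zs_ract (linear_add (zcoef_lin _ _)); exact: ractDr. Qed.
Lemma zs_ractZl k (x : zs_fiber u) a : zs_ract (k *: x) a = k *: zs_ract x a.
Proof. exact: ractZl. Qed.
Lemma zs_ractZr k (x : zs_fiber u) a : zs_ract x (k *: a) = k *: zs_ract x a.
Proof. by rewrite /zs_ract (linear_scale (zcoef_lin _ _)); exact: ractZr. Qed.
Lemma zs_ractM (x : zs_fiber u) a b : zs_ract x (a ** b) = zs_ract (zs_ract x a) b.
Proof. by rewrite /zs_ract zcoef_mul; exact: ractM. Qed.
Lemma zs_ract1 (x : zs_fiber u) : zs_ract x cone = x.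
Proof. by rewrite /zs_ract zcoef_one; exact: ract1. Qed.
Lemma zs_innerDr (x y z : zs_fiber u) : zs_inner x (y + z) = zs_inner x y + zs_inner x z.
Proof. by rewrite /zs_inner -(linear_add (zcoef_lin _ _)) -innerDr. Qed.
Lemma zs_innerZr k (x y : zs_fiber u) : zs_inner x (k *: y) = k *: zs_inner x y.
Proof. by rewrite /zs_inner -(linear_scale (zcoef_lin _ _)) -innerZr. Qed.
Lemma zs_inner_ract (x y : zs_fiber u) a : zs_inner x (zs_ract y a) = zs_inner x y ** a.
Proof. by rewrite /zs_inner /zs_ract inner_ract zcoef_mul zcoefK. Qed.
Lemma zs_inner_star (x y : zs_fiber u) : star (zs_inner x y) = zs_inner y x.
Proof. by rewrite /zs_inner -zcoef_star inner_star. Qed.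
Lemma zs_inner_ge0 (x : zs_fiber u) : exists c : A, zs_inner x x = star c ** c.
Proof.
have [c xc] := @inner_ge0 R A (X u.1) x; exists (zcoef beta u.2^-1%g c).
by rewrite /zs_inner xc zcoef_mul zcoef_star.
Qed.
Lemma zs_norm_inner (x : zs_fiber u) : `|x| ^+ 2 = `|zs_inner x x|.
Proof.
rewrite [RHS]normRE /zs_inner normR_zcoef -normRE.
exact: (@norm_inner R A (X u.1)).
Qed.

HB.instance Definition _ := isHilbertModule.Build R A (zs_fiber u)
  zs_ractDl zs_ractDr zs_ractZl zs_ractZr zs_ractM zs_ract1
  zs_innerDr zs_innerZr zs_inner_ract zs_inner_star zs_inner_ge0 zs_norm_inner.

Lemma zs_lactD a b (x : zs_fiber u) : zs_lact (a + b) x = zs_lact a x + zs_lact b x.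
Proof. exact: lactD. Qed.
Lemma zs_lactZ k a (x : zs_fiber u) : zs_lact (k *: a) x = k *: zs_lact a x.
Proof. exact: lactZ. Qed.
Lemma zs_lactM a b (x : zs_fiber u) : zs_lact (a ** b) x = zs_lact a (zs_lact b x).
Proof. exact: lactM. Qed.
Lemma zs_lact_adj a (x y : zs_fiber u) : inner (zs_lact a x) y = inner x (zs_lact (star a) y).
Proof. by rewrite [LHS]/(zs_inner _ _) /zs_inner lact_adj. Qed.

HB.instance Definition _ := isCorrespondence.Build R A (zs_fiber u)
  zs_lactD zs_lactZ zs_lactM zs_lact_adj.

Definition zs_corr : correspondenceType A := zs_fiber u.
End ZSFiber.

Section ZSProductSystem.
Context {R : realType} {A : cstarAlgType R} {P : monoidType} {G : groupType}.
Context {Z : zappa_szep P G} {X : product_system A P} (beta : zs_action Z X).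
Local Notation Y := (zs_corr beta).

(* The element x (x) g. *)
Definition ztensor p (x : X p) (g : G) : Y (p, g) := x.

Definition zs_psmul (u v : zs_prod Z) (x : Y u) (y : Y v) : Y (u * v)%g :=
  psmul X (x : X u.1) (zbeta beta u.2 (y : X v.1)).

Definition zs_ps1 (a : A) : Y 1%g := ps1 X a.
Definition zs_ps1_inv (x : Y 1%g) : A := ps1_inv (x : X 1%g).

Lemma tot_zs (u v : zs_prod Z) (x : Y u) (y : Y v) : u.2 = v.2 ->
  tot (x : X u.1) = tot (y : X v.1) -> tot x = tot y.
Proof.
case: u x => [p g] x; case: v y => [q h] y /= e; case: _ / e y => y.
by case/totP => e; case: _ / e y => y /= <-.
Qed.

Lemma zs_psmulA (u v w : zs_prod Z) (x : Y u) (y : Y v) (z : Y w) :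
  tot (zs_psmul x (zs_psmul y z)) = tot (zs_psmul (zs_psmul x y) z).
Proof.
apply: tot_zs.
  by rewrite -[LHS]/((u * (v * w))%g.2) mulgA.
rewrite /zs_psmul /= (tot_psmul (erefl (tot (x : X u.1))) (zbeta_mul beta _ _ _)).
rewrite psmulA; apply: tot_psmul => //.
by rewrite zbetaM.
Qed.

Lemma zs_ps1K : cancel zs_ps1 zs_ps1_inv. Proof. exact: ps1K. Qed.
Lemma zs_ps1_invK : cancel zs_ps1_inv zs_ps1. Proof. exact: ps1_invK. Qed.
Lemma zs_ps1_linear : linear zs_ps1. Proof. exact: ps1_linear. Qed.
Lemma zs_ps1_lact a b : zs_ps1 (a ** b) = lact a (zs_ps1 b).
Proof. exact: ps1_lact. Qed.
Lemma zs_ps1_ract a b : zs_ps1 (a ** b) = ract (zs_ps1 a) b.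
Proof.
rewrite -[RHS]/(ract (ps1 X a) (zcoef beta 1%g b)) zcoef1; exact: ps1_ract.
Qed.
Lemma zs_ps1_inner a b : inner (zs_ps1 a) (zs_ps1 b) = star a ** b.
Proof.
rewrite -[LHS]/(zcoef beta 1^-1%g (inner (ps1 X a) (ps1 X b))) ps1_inner.
by rewrite invg1 zcoef1.
Qed.
Lemma zs_psmul_lact u a (x : Y u) : tot (zs_psmul (zs_ps1 a) x) = tot (lact a x).
Proof.
apply: tot_zs; first by rewrite -[LHS]/((1 * u)%g.2) mul1g.
rewrite -[tot (lact a x : X u.1)]/(tot (lact a (x : X u.1))) -psmul_lact.
by apply: tot_psmul => //; rewrite zbeta1.
Qed.
Lemma zs_psmul_ract u a (x : Y u) : tot (zs_psmul x (zs_ps1 a)) = tot (ract x a).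
Proof.
apply: tot_zs; first by rewrite -[LHS]/((u * 1)%g.2) mulg1.
rewrite -[tot (ract x a : X u.1)]/(tot (ract (x : X u.1) (zcoef beta u.2 a))).
by rewrite -psmul_ract; apply: tot_psmul => //; rewrite -tot_zcoef.
Qed.

Lemma unitary_map_id (E : hilbertModType A) : unitary_map (@id E).
Proof. by exists id; split. Qed.

Lemma zs_psmul_unitary (u v : zs_prod Z) : extends_to_unitary (@zs_psmul u v).
Proof.
exists (Y (u * v)%g), (@zs_psmul u v), id; split; [|exact: unitary_map_id|by []].
have [[linr linl] innX dens] := psmul_facts X u.1 (zact Z u.2 v.1).
have inn (x : Y u) (y : Y v) (x' : Y u) (y' : Y v) :
    inner (zs_psmul x y) (zs_psmul x' y') = inner y (lact (inner x x') y').
  rewrite -[LHS]/(zcoef beta ((zres Z v.1 u.2 * v.2)%g)^-1%g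
    (inner (psmul X (x : X u.1) (zbeta beta u.2 (y : X v.1)))
           (psmul X (x' : X u.1) (zbeta beta u.2 (y' : X v.1))))).
  rewrite -[RHS]/(zcoef beta v.2^-1%g (inner (y : X v.1)
    (lact (zcoef beta u.2^-1%g (inner (x : X u.1) (x' : X u.1))) (y' : X v.1)))).
  rewrite innX -[inner (x : X u.1) _](zcoefVK beta u.2) -zbeta_lact zbeta_inner.
  rewrite -[zcoef_map _ _ _]/(zcoef beta _ _) zcoefM invgM -mulgA mulVg mulg1.
  by rewrite zcoefVK.
split=> //.
- split=> [x k y y'|y k x x'] /=.
    by rewrite /zs_psmul zbeta_linear; exact: linr.
  by rewrite /zs_psmul; exact: linl.
- move=> x a y; rewrite /zs_psmul -[lact a y]/(lact a (y : X v.1)) zbeta_lact.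
  exact: tot_inj (psmul_balanced (x : X u.1) _ _).
- move=> x y a; rewrite -[LHS]/(psmul X (x : X u.1)
    (zbeta beta u.2 (ract (y : X v.1) (zcoef beta v.2 a)))).
  by rewrite zbeta_ract zcoefM; exact: psmul_ractr.
- apply/closure_setTP => w e e0; have [s Hs] := dens w e e0.
  pose pre (y : X (zact Z u.2 v.1)) : X v.1 := xget 0 [set y0 | zbeta beta u.2 y0 = y].
  have preK y : zbeta beta u.2 (pre y) = y.
    by rewrite /pre; case: xgetP => // /(_ (projT1 (cid (zbeta_surj beta y))));
       case: cid => y0 /= ->.
  exists (\sum_(z <- s) psmul X z.1 z.2); last exact: Hs.
  exists [seq (z.1, pre z.2) | z <- s]; rewrite big_map.
  by apply: eq_bigr => z _; rewrite /zs_psmul /= preK.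
Qed.

Definition zs_product_system : product_system A (zs_prod Z) :=
  @ProductSystem R A (zs_prod Z) Y zs_psmul zs_ps1 zs_ps1_inv zs_psmulA zs_ps1K
    zs_ps1_invK zs_ps1_linear zs_ps1_lact zs_ps1_ract zs_ps1_inner
    zs_psmul_unitary zs_psmul_lact zs_psmul_ract.

End ZSProductSystem.

Record representation (R : realType) (A : cstarAlgType R) (P : monoidType)
    (X : product_system A P) (B : cstarAlgType R) := Representation {
  rep : forall p, X p -> B;
  rep_linear : forall p, linear (@rep p);
  rep_hom : star_hom (fun a : A => rep (ps1 X a));
  rep_mul : forall p q (x : X p) (y : X q), rep x ** rep y = rep (psmul X x y);
  rep_inner : forall p (x y : X p),
    star (rep x) ** rep y = rep (ps1 X (inner x y))
}.
Arguments rep {R A P X B} _ {p}.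

Definition unitary_representation (R : realType) (B : cstarAlgType R)
    (G : groupType) (U : G -> B) : Prop :=
  [/\ U 1%g = cone, forall g h, U (g * h)%g = U g ** U h &
      forall g, star (U g) ** U g = cone /\ U g ** star (U g) = cone].

Record covariant_representation (R : realType) (A : cstarAlgType R)
    (P : monoidType) (G : groupType) (Z : zappa_szep P G)
    (X : product_system A P) (beta : zs_action Z X) (B : cstarAlgType R) :=
    CovariantRepresentation {
  cov_rep : representation X B;
  cov_group : G -> B;
  cov_unitary : unitary_representation cov_group;
  cov_commute : forall g p (x : X p),
    cov_group g ** rep cov_rep x
      = rep cov_rep (zbeta beta g x) ** cov_group (zres Z p g)
}.

(* Main.v *)
(* Covariance lets U_g be moved to the right past psi_p(x), so x (x) g |->
   psi_p(x) U_g is multiplicative; at p = e it reads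
   U_g^* psi_e(a) U_g = psi_e(beta_{g^-1}(a)), which gives the inner products.
   Conversely x (x) g = (x (x) e)(1 (x) g), so Psi is determined by psi and U, and
   both sides of the covariance relation are the image of beta_g(x) (x) g|_p. *)
Require Import Defs.
From HB Require Import structures.
From mathcomp Require Import all_boot all_order all_algebra.
From mathcomp Require Import complex.
From mathcomp Require Import boolp classical_sets reals topology normedtype.

Import Order.TTheory GRing.Theory Num.Theory.
Import numFieldNormedType.Exports.

Local Open Scope ring_scope.
Local Open Scope cstar_scope.

(** * Equality and units for representations of a product system *)

Section Representation.
Context {R : realType} {A : cstarAlgType R} {P : monoidType}.
Context {X : product_system A P} {B : cstarAlgType R}.
Implicit Types psi : representation X B.

Lemma rep_tot psi {p q} {x : X p} {y : X q} : tot x = tot y -> rep psi x = rep psi y.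
Proof. by case/totP => e; case: _ / e y => y /= <-. Qed.

(** The fields other than [rep] are propositions, so proof irrelevance reduces equality to the
    family of maps. *)
Lemma rep_ext psi psi' :
  (forall p (x : X p), rep psi x = rep psi' x) -> psi = psi'.
Proof.
case: psi psi' => [f lf hf mf nf] [f' lf' hf' mf' nf'] /= ff'.
have e : f = f' by apply: functional_extensionality_dep => p; apply: funext.
by subst f'; congr Representation; exact: Prop_irrelevance.
Qed.

Lemma rep_one psi : rep psi (ps1 X cone) = cone.
Proof. by case: (rep_hom psi). Qed.

(* The left action of A is not assumed to be unital; only its image is. *)
Lemma rep_lact1 psi {p} (x : X p) : rep psi (lact cone x) = rep psi x.
Proof. by rewrite -(rep_tot psi (psmul_lact cone x)) -rep_mul rep_one cmul1l. Qed.

End Representation.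

(** * Consequences of the covariance relation *)

Section CovariantRepresentation.
Context {R : realType} {A : cstarAlgType R} {P : monoidType} {G : groupType}.
Context {Z : zappa_szep P G} {X : product_system A P} {beta : zs_action Z X}.
Context {B : cstarAlgType R}.
Implicit Types psiU : covariant_representation beta B.

Lemma cov_ext psiU psiU' :
  (forall p (x : X p), rep (cov_rep psiU) x = rep (cov_rep psiU') x) ->
  cov_group psiU =1 cov_group psiU' -> psiU = psiU'.
Proof.
move=> /rep_ext; case: psiU psiU' => [f U hU cU] [f' U' hU' cU'] /= ff' /funext UU'.
by subst f' U'; congr CovariantRepresentation; exact: Prop_irrelevance.
Qed.

Lemma cov_group1 psiU : cov_group psiU 1%g = cone.
Proof. by case: (cov_unitary psiU). Qed.

Lemma cov_groupM psiU g h :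
  cov_group psiU (g * h)%g = cov_group psiU g ** cov_group psiU h.
Proof. by case: (cov_unitary psiU). Qed.

Lemma cov_groupV psiU g : cov_group psiU g^-1%g = star (cov_group psiU g).
Proof.
have [_ _ /(_ g)[UU _]] := cov_unitary psiU.
by rewrite -[LHS]cmul1l -UU -cmulA -cov_groupM mulgV cov_group1 cmul1r.
Qed.

(** With [star (U g)] written as [U g^-1], this is covariance on the identity fibre: restriction at
    the identity is trivial ([zres_id]), so the [U g^-1] that comes out on the right cancels
    [U g]. *)
Lemma cov_group_conj psiU g a :
  star (cov_group psiU g) ** rep (cov_rep psiU) (ps1 X a) ** cov_group psiU g
    = rep (cov_rep psiU) (ps1 X (zcoef beta g^-1%g a)).
Proof.
rewrite -cov_groupV cov_commute zres_id -cmulA -cov_groupM mulVg cov_group1 cmul1r.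
by apply: rep_tot; rewrite tot_zcoef.
Qed.

End CovariantRepresentation.

(** * From a covariant pair to a representation of the Zappa-Szép product system *)

Section Integrated.
Context {R : realType} {A : cstarAlgType R} {P : monoidType} {G : groupType}.
Context {Z : zappa_szep P G} {X : product_system A P} {beta : zs_action Z X}.
Context {B : cstarAlgType R} (psiU : covariant_representation beta B).
Local Notation Y := (zs_product_system beta).
Local Notation psi := (cov_rep psiU).
Local Notation U := (cov_group psiU).

Definition integrated_map (u : zs_prod Z) (x : Y u) : B :=
  rep psi (x : X u.1) ** U u.2.

Lemma integrated_linear u : linear (@integrated_map u).
Proof.
move=> k x y; rewrite /integrated_map -cmulZl -cmulDl.
by congr (_ ** _); exact: rep_linear.
Qed.

Lemma integrated_ps1 a : integrated_map _ (ps1 Y a) = rep psi (ps1 X a).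
Proof. by rewrite /integrated_map cov_group1 cmul1r. Qed.

Lemma integrated_hom : star_hom (fun a : A => integrated_map _ (ps1 Y a)).
Proof.
have [lh mh sh oh] := rep_hom psi.
split=> [k a b|a b|a|]; rewrite !integrated_ps1;
  by [exact: lh|exact: mh|exact: sh|exact: oh].
Qed.

Lemma integrated_mul u v (x : Y u) (y : Y v) :
  integrated_map _ x ** integrated_map _ y = integrated_map _ (psmul Y x y).
Proof.
rewrite /integrated_map cmulA -[_ ** U u.2 ** _]cmulA cov_commute cmulA rep_mul.
by rewrite -cmulA -cov_groupM.
Qed.

Lemma integrated_inner u (x y : Y u) :
  star (integrated_map _ x) ** integrated_map _ y
    = integrated_map _ (ps1 Y (inner x y)).
Proof.
rewrite integrated_ps1 /integrated_map starM cmulA -[_ ** star _ ** _]cmulA.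
(* The twist by [zcoef beta u.2^-1] produced here is the one built into the inner product of [Y], so
   both sides agree by conversion. *)
by rewrite rep_inner cov_group_conj.
Qed.

Definition integrated_rep : representation Y B :=
  Representation integrated_linear integrated_hom integrated_mul integrated_inner.

End Integrated.

(** * From a representation of the Zappa-Szép product system to a covariant pair *)

Section Restricted.
Context {R : realType} {A : cstarAlgType R} {P : monoidType} {G : groupType}.
Context {Z : zappa_szep P G} {X : product_system A P} {beta : zs_action Z X}.
Context {B : cstarAlgType R} (Psi : representation (zs_product_system beta) B).
Local Notation Y := (zs_product_system beta).

Definition restricted_map {p} (x : X p) : B := rep Psi (ztensor beta x 1%g).
Definition restricted_group (g : G) : B := rep Psi (ztensor beta (ps1 X cone) g).

Lemma tot_ztensor p q (x : X p) (y : X q) g h :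
  tot x = tot y -> g = h -> tot (ztensor beta x g) = tot (ztensor beta y h).
Proof. by move=> xy gh; apply: tot_zs. Qed.

Lemma rep_ztensorM p q (x : X p) (y : X q) g h :
  rep Psi (ztensor beta x g) ** rep Psi (ztensor beta y h)
    = rep Psi (ztensor beta (psmul X x (zbeta beta g y)) (zres Z q g * h)%g).
Proof. exact: rep_mul. Qed.

(** Products of tensors lie over indices that are only propositionally equal; this compares the two
    tensor components separately. *)
Lemma rep_ztensor_eq {p q} {x : X p} {y : X q} {g h} :
  tot x = tot y -> g = h -> rep Psi (ztensor beta x g) = rep Psi (ztensor beta y h).
Proof. by move=> xy gh; apply/rep_tot/tot_ztensor. Qed.

Lemma rep_ztensor_inner p (x y : X p) g :
  star (rep Psi (ztensor beta x g)) ** rep Psi (ztensor beta y g)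
    = rep Psi (ztensor beta (ps1 X (zcoef beta g^-1%g (inner x y))) 1%g).
Proof. exact: rep_inner. Qed.

Lemma tot_zbeta_one g : tot (zbeta beta g (ps1 X cone)) = tot (ps1 X cone).
Proof. by rewrite -tot_zcoef zcoef_one. Qed.

(** The product of [x] (x) e and 1 (x) g is [x] (x) g, as e restricts to e and [zbeta] fixes the
    unit. This recovers [Psi] from the restricted pair. *)
Lemma restricted_split p (x : X p) g :
  restricted_map x ** restricted_group g = rep Psi (ztensor beta x g).
Proof.
rewrite rep_ztensorM; apply: rep_ztensor_eq; last by rewrite zres1 mul1g.
by rewrite (tot_psmul (erefl (tot x)) (tot_zbeta_one _)) psmul_ract ract1.
Qed.

Lemma restricted_linear p : linear (@restricted_map p).
Proof. by move=> k x y; exact: (@rep_linear _ _ _ _ _ Psi (p, 1%g)). Qed.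

Lemma restricted_hom : star_hom (fun a : A => restricted_map (ps1 X a)).
Proof. exact: (rep_hom Psi). Qed.

Lemma restricted_mul p q (x : X p) (y : X q) :
  restricted_map x ** restricted_map y = restricted_map (psmul X x y).
Proof.
rewrite rep_ztensorM; apply: rep_ztensor_eq; last by rewrite zres1 mul1g.
by apply: tot_psmul; rewrite ?zbeta1.
Qed.

Lemma restricted_inner p (x y : X p) :
  star (restricted_map x) ** restricted_map y = restricted_map (ps1 X (inner x y)).
Proof. by rewrite rep_ztensor_inner invg1 zcoef1. Qed.

Definition restricted_rep : representation X B :=
  Representation restricted_linear restricted_hom restricted_mul restricted_inner.

Lemma restricted_group1 : restricted_group 1%g = cone.
Proof. exact: (rep_one restricted_rep). Qed.

Lemma restricted_groupM g h :
  restricted_group (g * h)%g = restricted_group g ** restricted_group h.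
Proof.
rewrite rep_ztensorM; apply/esym/rep_ztensor_eq; last by rewrite zres_id.
by rewrite (tot_psmul (erefl _) (tot_zbeta_one _)) psmul_ract ract1.
Qed.

(** The inner product of 1 (x) g with itself is the image of 1 under the automorphism of g^-1, hence
    1. *)
Lemma restricted_group_isometry g :
  star (restricted_group g) ** restricted_group g = cone.
Proof.
rewrite rep_ztensor_inner ps1_inner star1 cmul1l zcoef_one.
exact: restricted_group1.
Qed.

Lemma restricted_unitary : unitary_representation restricted_group.
Proof.
split=> [||g]; [exact: restricted_group1|exact: restricted_groupM|].
split; first exact: restricted_group_isometry.
(* Multiplicativity supplies a right inverse, and an isometry with a right inverse has it as
   adjoint. *)
suff -> : star (restricted_group g) = restricted_group g^-1%g.
  by rewrite -restricted_groupM mulgV restricted_group1.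
rewrite -[LHS]cmul1r -restricted_group1 -(mulgV g) restricted_groupM cmulA.
by rewrite restricted_group_isometry cmul1l.
Qed.

Lemma restricted_commute g p (x : X p) :
  restricted_group g ** rep restricted_rep x
    = rep restricted_rep (zbeta beta g x) ** restricted_group (zres Z p g).
Proof.
rewrite restricted_split [LHS]rep_ztensorM mulg1.
(* The left side carries the product of 1 with [zbeta beta g x], that is, a left action by [cone],
   which is absorbed after applying [Psi]. *)
rewrite (rep_ztensor_eq (psmul_lact _ _) erefl).
exact: (rep_lact1 Psi (ztensor beta (zbeta beta g x) (zres Z p g))).
Qed.

Definition restricted_cov : covariant_representation beta B :=
  CovariantRepresentation restricted_unitary restricted_commute.

End Restricted.

Theorem theorem4p2 (R : realType) (P : monoidType) (G : groupType)
    (Z : zappa_szep P G) (A : cstarAlgType R) (X : product_system A P)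
    (beta : zs_action Z X) (B : cstarAlgType R) :
  exists (Pi : representation (zs_product_system beta) B ->
               covariant_representation beta B)
         (Pi_inv : covariant_representation beta B ->
                   representation (zs_product_system beta) B),
    [/\ cancel Pi Pi_inv,
        cancel Pi_inv Pi,
        forall Psi : representation (zs_product_system beta) B,
          (forall p (x : X p),
             rep (cov_rep (Pi Psi)) x = rep Psi (ztensor beta x 1%g)) /\
          (forall g : G,
             cov_group (Pi Psi) g = rep Psi (ztensor beta (ps1 X cone) g)) &
        forall (psiU : covariant_representation beta B) p (g : G) (x : X p),
          rep (Pi_inv psiU) (ztensor beta x g)
            = rep (cov_rep psiU) x ** cov_group psiU g].
Proof.
exists restricted_cov, integrated_rep; split=> //.
- by move=> Psi; apply: rep_ext => -[p g] x; exact: restricted_split.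
- move=> psiU; apply: cov_ext => [p x|g] /=.
    (* Setting g = e leaves the factor [U 1], which is the unit; for the group part, setting x = 1
       leaves the image of 1, again the unit. *)
    by rewrite /restricted_map /= /integrated_map /= cov_group1 cmul1r.
  by rewrite /restricted_group /= /integrated_map /= rep_one cmul1l.
Qed.
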